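(* Let $k\ge 2$ and $n\ge 1$ be integers, and let $\gamma^{(1)},\delta^{(1)},\ldots,\gamma^{(k)},\delta^{(k)}$ be compositions of $n$. If for every $t\in[k]$ the compositions $\gamma^{(t)}$ and $\delta^{(t)}$ have the same length, then $c(\gamma^{(1)},\ldots,\gamma^{(k)})=c(\delta^{(1)},\ldots,\delta^{(k)})$, where $c(\gamma^{(1)},\ldots,\gamma^{(k)})$ denotes the number of colored factorizations of the permutation $(1,2,\ldots,n)$ having color-compositions $(\gamma^{(1)},\ldots,\gamma^{(k)})$.
   Context: For a positive integer $m$, $[m]=\{1,\ldots,m\}$. A composition of $n$ is a finite sequence of positive integers (its parts) with sum $n$; its length is the number of parts. Given positive integers $p_1,\ldots,p_k$, a $(p_1,\ldots,p_k)$-colored factorization of the long cycle $(1,2,\ldots,n)$ is a tuple $(\pi_1,\ldots,\pi_k,\phi_1,\ldots,\phi_k)$ where $\pi_1,\ldots,\pi_k$ are permutations of $[n]$ with $\pi_1\circ\cdots\circ\pi_k=(1,2,\ldots,n)$ and, for all $t\in[k]$, $\phi_t:[n]\to[p_t]$ is a surjective map such that $\phi_t(a)=\phi_t(b)$ whenever $a,b$ are in the same cycle of $\pi_t$. If $\gamma^{(t)}=(\gamma^{(t)}_1,\ldots,\gamma^{(t)}_{p_t})$ is a composition of $n$ of length $p_t$ for each $t\in[k]$, the colored factorization has color-compositions $(\gamma^{(1)},\ldots,\gamma^{(k)})$ if $|\phi_t^{-1}(i)|=\gamma^{(t)}_i$ for all $t\in[k]$ and $i\in[p_t]$. *)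

(* Defs.v *)
From mathcomp Require Import all_boot all_fingroup.

Set Implicit Arguments.
Unset Strict Implicit.
Unset Printing Implicit Defensive.

(* Points and colors are numbered from 0: the set {1,...,m} is encoded as 'I_m. *)

Definition is_composition (n : nat) (s : seq nat) : bool :=
  all (fun m => 0 < m) s && (sumn s == n).

(* The cyclic permutation i |-> i + 1 mod n of 'I_n. *)
Definition long_cycle (n : nat) : 'S_n := perm (@ordS_inj n).

(* MathComp permutations multiply from left to right, (s * t) x = t (s x),
   so the indices are reversed: compose pi x = pi_0 (pi_1 (... (pi_(k-1) x))). *)
Definition compose (k n : nat) (pi : 'I_k -> 'S_n) : 'S_n :=
  (\prod_(t < k) pi (rev_ord t))%g.

(* The candidates (pi_1,...,pi_k,phi_1,...,phi_k), with phi_t : [n] -> [p_t]. *)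
Definition colored_tuple (k n : nat) (p : 'I_k -> nat) : finType :=
  ({ffun 'I_k -> 'S_n} *
   {dffun forall t : 'I_k, {ffun 'I_n -> 'I_(p t)}})%type.

Definition is_colored_factorization (k n : nat) (p : 'I_k -> nat)
    (F : colored_tuple n p) : bool :=
  let: (pi, phi) := F in
  [&& compose pi == long_cycle n,
      [forall t, forall c, exists a, phi t a == c]
    & [forall t, forall a, forall b,
         (b \in porbit (pi t) a) ==> (phi t a == phi t b)]].

Definition has_color_compositions (k n : nat) (p : 'I_k -> nat)
    (gamma : 'I_k -> seq nat) (F : colored_tuple n p) : bool :=
  [forall t, (size (gamma t) == p t) &&
     [forall c : 'I_(p t), #|[set a | F.2 t a == c]| == nth 0 (gamma t) c]].

Definition count_colored_factorizations (k n : nat)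
    (gamma : 'I_k -> seq nat) : nat :=
  #|[set F : colored_tuple n (fun t => size (gamma t)) |
       is_colored_factorization F & has_color_compositions gamma F]|.

(* Main.v *)
Require Import Defs.
From mathcomp Require Import all_boot all_fingroup zify.

(** Fix a permutation z and count the pairs (phi, s) where phi is a coloring of
    type g, s preserves phi, and z s is a full cycle.  This number depends only
    on the number of colors: moving weight between two colors i and j, one
    freezes the rest of the coloring, the merged set U of points of color i or
    j, and the part t of s acting outside U.  If B and C are the color classes
    of i and j, the number of ways to complete s on B and C is
    (|B|-1)! (|C|-1)! times the number of x in B whose first return to U under
    z t lies in C (a two-vertex instance of the BEST theorem), or 0 if some
    cycle of z t avoids U.  Summing over the splittings U = B + C with
    prescribed sizes leaves (|U|-2)! times the number of points of U that are
    not fixed by the first return, which does not involve |B| and |C|.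

    Since fullness of a product is invariant under cyclic rotation of the
    factors, the color-compositions can then be replaced one factor at a time
    in the count of factorizations of an arbitrary full cycle; and all full
    cycles have as many colored factorizations, being conjugate. *)

Set Implicit Arguments.
Unset Strict Implicit.
Unset Printing Implicit Defensive.

(** * First return to a set *)

Section FirstReturn.

Variable T : finType.
Implicit Types (s k : {perm T}) (U B C : {set T}).

Definition meets s U := [forall x, [exists y in U, y \in porbit s x]].

(* The point of U first reached from x after at least one step; junk unless the
   cycle of x meets U. *)
Definition ret U s x :=
  iter (find (fun m => iter m.+1 s x \in U) (iota 0 #[s]%g)).+1 s x.

Lemma meetsP s U :
  reflect (forall x, exists m, iter m s x \in U) (meets s U).
Proof.
apply: (iffP forallP) => H x.
  have /exists_inP[y yU /porbitP[m Dy]] := H x.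
  by exists m; rewrite -permX -Dy.
have [m Um] := H x; apply/exists_inP; exists (iter m s x) => //.
by rewrite -permX mem_porbit.
Qed.

Lemma meetsS s U C : U \subset C -> meets s U -> meets s C.
Proof.
by move=> /subsetP UC /meetsP H; apply/meetsP => x; have [m /UC] := H x; exists m.
Qed.

Lemma iter_modn_order s m x : iter (m %% #[s]%g) s x = iter m s x.
Proof. by rewrite -!permX expg_mod_order. Qed.

Lemma ret_eq U s x m :
    iter m.+1 s x \in U -> (forall i, i < m -> iter i.+1 s x \notin U) ->
  ret U s x = iter m.+1 s x.
Proof.
move=> Um minm; rewrite /ret.
(* The search in [ret] stops at the order of [s]. A first hit cannot come later: by periodicity, [m
   %% #[s]] would be an earlier one. *)
have ltm : m < #[s]%g.
  have lt_mod : m %% #[s]%g < #[s]%g by rewrite ltn_mod order_gt0.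
  rewrite ltnNge; apply/negP => le_m.
  have := minm _ (leq_trans lt_mod le_m).
  by rewrite iterS iter_modn_order -iterS Um.
case: findP => [/hasPn /(_ m)|i]; first by rewrite mem_iota ltm Um => /(_ isT).
rewrite size_iota => lti /(_ 0); rewrite nth_iota // add0n => Ui mini.
have ->  : i = m; last by [].
case: (ltngtP i m) => // [/minm|/(mini 0)]; first by rewrite Ui.
by rewrite nth_iota // add0n Um.
Qed.

Lemma retP U s x : meets s U ->
  exists m, [/\ ret U s x = iter m.+1 s x, iter m.+1 s x \in U
              & forall i, i < m -> iter i.+1 s x \notin U].
Proof.
move=> /meetsP/(_ (s x))[m0 Um0].
have [m Um minm] : exists2 m, iter m.+1 s x \in U
    & forall i, i < m -> iter i.+1 s x \notin U.
  have exm : exists m, iter m.+1 s x \in U by exists m0; rewrite iterSr.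
  exists (ex_minn exm); first by case: ex_minnP.
  by case: ex_minnP => m _ minm i; rewrite ltnNge; apply: contra => /minm.
by exists m; split=> //; apply: ret_eq.
Qed.

Lemma ret_in U s x : meets s U -> ret U s x \in U.
Proof. by move=> /(retP x)[m [-> ]]. Qed.

(** Since [k] moves only points of [U], it does not act along a run outside [U]; only the last point
    of the run can feel it. *)
Lemma iter_mul_off U s k x m : perm_on U k ->
    (forall i, i < m -> iter i.+1 s x \notin U) ->
  iter m.+1 (s * k)%g x = k (iter m.+1 s x).
Proof.
move=> Uk; elim: m => [|m IHm] offU; first by rewrite /= permM.
rewrite iterS permM IHm => [|i lti]; last by apply: offU; lia.
by rewrite (out_perm Uk (offU m _)).
Qed.

Lemma meets_mulS U s k : perm_on U k -> meets s U -> meets (s * k)%g U.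
Proof.
move=> Uk sU; apply/meetsP => x; have [m [_ Um minm]] := retP x sU.
by exists m.+1; rewrite (iter_mul_off Uk minm) (perm_closed _ Uk).
Qed.

Lemma meets_mul U s k : perm_on U k -> meets (s * k)%g U = meets s U.
Proof.
move=> Uk; apply/idP/idP; last exact: meets_mulS.
by move/(meets_mulS (perm_onV Uk)); rewrite mulgK.
Qed.

Lemma ret_mul U s k x :
  perm_on U k -> meets s U -> ret U (s * k)%g x = k (ret U s x).
Proof.
move=> Uk sU; have [m [-> Um minm]] := retP x sU.
rewrite -(iter_mul_off Uk minm); apply: ret_eq => [|i lti].
  by rewrite (iter_mul_off Uk minm) (perm_closed _ Uk).
rewrite (iter_mul_off Uk) ?(perm_closed _ Uk) ?minm // => j ltj.
by apply: minm; lia.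
Qed.

(** Removing [x] can spoil only the cycle of [x], and does so when that cycle meets [U] in [x]
    alone, that is, when [x] is its own first return. *)
Lemma meetsD1 U s x : x \in U -> meets s U ->
  meets s (U :\ x) = (ret U s x != x).
Proof.
move=> Ux sU; have [m [Dr Um minm]] := retP x sU; apply/idP/idP.
  apply: contraL => /eqP rx; apply/negP => /meetsP/(_ x)[i].
  (* A return to [x] itself after [m.+1] steps makes the orbit periodic with that period. *)
  have per : iter i s x = iter (i %% m.+1) s x.
    rewrite {1}(divn_eq i m.+1) addnC iterD; congr (iter _ _ _).
    by elim: (i %/ _) => [//|q IHq]; rewrite mulSn iterD IHq -Dr.
  rewrite per !inE; case Dj: (i %% m.+1) => [|j]; first by rewrite /= eqxx.
  rewrite (negPf (minm j _)) ?andbF //.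
  by rewrite -ltnS -Dj ltn_mod.
move=> rx; apply/meetsP => z; have [i Ui] := meetsP _ _ sU z.
have [Dx|zx] := eqVneq (iter i s z) x; last by exists i; rewrite !inE zx.
by exists (m.+1 + i); rewrite iterD Dx -Dr !inE rx ret_in.
Qed.

(** A return that lands on the deleted point [x] runs on to the next return, which is not [x]
    again. *)
Lemma retD1 U s x z : x \in U -> meets s U -> ret U s x != x ->
  ret (U :\ x) s z = if ret U s z == x then ret U s x else ret U s z.
Proof.
move=> Ux sU rx; have [m [Dr Um minm]] := retP z sU.
have offx i y : i \notin U -> i \notin U :\ y by rewrite !inE negb_and orbC => ->.
case: eqVneq => [Dx|zx]; last first.
  by rewrite Dr; apply: ret_eq => [|i /minm/offx //]; rewrite !inE -Dr zx Dr.
have [p [Drx Up minp]] := retP x sU; rewrite Drx.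
have shift i : iter (i.+1 + m.+1) s z = iter i.+1 s x by rewrite iterD -Dr Dx.
rewrite -(shift p) addSn; apply: ret_eq; rewrite -?addSn ?shift.
  by rewrite !inE -Drx rx Drx.
move=> i lti; case: (ltngtP i m) => [/minm/offx //|gti|->].
  rewrite (_ : i.+1 = (i - m.+1).+1 + m.+1); last by lia.
  by rewrite shift offx // minp //; lia.
by rewrite -Dr Dx !inE eqxx.
Qed.

End FirstReturn.

(** * Completing a permutation to one with prescribed cycle hits *)

Section SymSums.

Variable T : finType.
Implicit Types (s k : {perm T}) (U B C : {set T}).

(** Coset decomposition: a permutation of [x |: B] sending [y] to [x] is [tperm x y] followed by a
    unique permutation of [B]. *)
Lemma sum_SymU1 B x (F : {perm T} -> nat) : x \notin B ->
  \sum_(k in Sym (x |: B)) F k =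
  \sum_(y in x |: B) \sum_(k in Sym B) F (tperm x y * k)%g.
Proof.
move=> Bx; rewrite (partition_big (fun k => (k^-1)%g x) (mem (x |: B))) /=.
  apply: eq_bigr => y Uy; rewrite (reindex_inj (mulgI (tperm x y))).
  apply: eq_bigl => k.
  rewrite groupMl; last first.
    rewrite inE; apply: (subset_trans (tperm_on x y)).
    by apply/subsetP => z /[!inE] /orP[]/eqP-> //; rewrite ?eqxx // -in_setU1.
  rewrite invMg tpermV permM -(inj_eq (@perm_inj _ (tperm x y))) tpermK tpermR.
  rewrite !inE; apply/andP/idP => [[onk /eqP kx]|onk].
    apply/subsetP => z /[dup] /(subsetP onk) /[!inE] /predU1P[-> | //].
    by rewrite -{1}kx permKV eqxx.
  split; last by rewrite -(inj_eq (@perm_inj _ k)) permKV (out_perm onk).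
  by apply: subset_trans onk _; apply: subsetUr.
by move=> k /[!inE] onk; rewrite -in_setU1 (perm_closed _ (perm_onV onk)) setU11.
Qed.

(** Induction on [#|B|]: a point [x] of [B] is split off with [sum_SymU1], its transposition is
    absorbed into [s], and the remaining factor permutes [B :\ x]. *)
Lemma sum_meets_Sym B C s : B != set0 -> [disjoint B & C] ->
  \sum_(k in Sym B) meets (s * k)%g C =
  meets s (B :|: C) * (#|B|.-1)`! * #|[set x in B | ret (B :|: C) s x \in C]|.
Proof.
rewrite -card_gt0; case Bn: #|B| => [//|n] _ /=.
elim: n B s Bn => [|n IHn] B s Bn dBC.
all: have [sU|NsU] := boolP (meets s (B :|: C)); rewrite ?mul1n; last first.
1,3: rewrite big1 // => k /[!inE] Bk; apply/eqP; rewrite eqb0.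
1,2: apply: contra NsU => /(meetsS (subsetUr B C)); rewrite meets_mul //.
1,2: by apply: subset_trans Bk _; apply: subsetUl.
  have /cards1P[x Dx] : #|B| == 1 by rewrite Bn.
  rewrite {}Dx in dBC sU *.
  have Cx : x \notin C by rewrite disjoints1 in dBC.
  rewrite (big_pred1 1%g) => [|k]; last first.
    rewrite /= inE; apply/idP/eqP => [/perm_on_id->|->]; rewrite ?perm_on1 //.
    by rewrite cards1.
  have DC : C = (x |: C) :\ x by rewrite setU1K.
  rewrite mulg1 {1}DC meetsD1 ?setU11 //.
  have := ret_in x sU; rewrite in_setU1 -sum1dep_card big_mkcondr big_set1 /=.
  by case: eqVneq => [->|_ /= ->] //; rewrite (negPf Cx).
have [x Bx] : exists x, x \in B by apply/card_gt0P; rewrite Bn.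
have Cx : x \notin C by rewrite (disjointFr dBC).
have B'x : x \notin B :\ x by rewrite setD11.
have B'n : #|B :\ x| = n.+1 by apply/eqP; rewrite -eqSS -Bn (cardsD1 x B) Bx.
have dB'C : [disjoint B :\ x & C] by apply: disjointWl dBC; apply: subD1set.
have Ux : x \in B :|: C by rewrite inE Bx.
have DU : (B :\ x) :|: C = (B :|: C) :\ x.
  by apply/setP => z; rewrite !inE; case: eqVneq => // ->; rewrite (negPf Cx).
rewrite -{1}(setD1K Bx) sum_SymU1 // (setD1K Bx).
set r := ret (B :|: C) s.
have UrE z : (r z \in B) = (r z \notin C).
  have := ret_in z sU; rewrite inE -/r => /orP[] rz.
    by rewrite (disjointFr dBC).
  by rewrite rz (disjointFl dBC).
(* Remove x from B: with s (x y) in place of s, the first return to B :\ x is r,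
   except that the unique z with r z = y is sent to r x; the case y = r x creates
   a cycle that misses B :\ x and contributes nothing. *)
pose f y z := (r x != y) && (if r z == y then r x \in C else r z \in C).
have eq_y y : y \in B ->
    \sum_(k in Sym (B :\ x)) meets (s * (tperm x y * k))%g C =
    n`! * \sum_(z in B :\ x) f y z.
  move=> By; under eq_bigr do rewrite mulgA.
  have Cy : y \notin C by rewrite (disjointFr dBC).
  have onU : perm_on (B :|: C) (tperm x y).
    apply: subset_trans (tperm_on x y) _.
    by apply/subsetP => z /[!inE] /orP[]/eqP->; rewrite ?Bx ?By.
  have sU' : meets (s * tperm x y)%g (B :|: C) by rewrite meets_mul.
  have r'E z : ret (B :|: C) (s * tperm x y)%g z = tperm x y (r z).
    by rewrite ret_mul.
  have txy u v : (tperm x y u == v) = (u == tperm x y v).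
    by rewrite -(inj_eq (@perm_inj _ (tperm x y))) tpermK.
  rewrite IHn // DU meetsD1 // r'E txy tpermL.
  have [rxy|rxy] := eqVneq (r x) y; rewrite ?mul0n ?mul1n.
    by rewrite big1 ?muln0 // => z _; rewrite /f rxy eqxx.
  congr (_ * _); rewrite -sum1dep_card big_mkcondr; apply: eq_bigr => z B'z.
  rewrite retD1 // ?r'E ?txy ?tpermL // /f rxy /=.
  have tC u : (tperm x y u \in C) = (u \in C).
    by case: tpermP => [->|->|//]; rewrite (negPf Cx) (negPf Cy).
  by case: (r z == y); rewrite tC; case: (_ \in C).
rewrite (eq_bigr _ eq_y) -big_distrr /= exchange_big /=.
rewrite factS -mulnA mulnCA; congr (_ * _).
rewrite -sum1dep_card big_mkcondr [in RHS](big_setD1 x) //=.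
(* It remains to count the good [y] for each [z] in [B :\ x]. If [r x] is in [C], all [n.+2] points
   of [B] are good when [r z] is in [C], and only [r z] otherwise; the one extra [y] for each [z]
   adds up to the [n.+1] owed to [x]. *)
have [rxC|rxC] := boolP (r x \in C).
  rewrite mulnDr muln1 -{1}B'n -sum1_card big_distrr -big_split /=.
  apply: eq_bigr => z B'z.
  have eq_f y : y \in B -> f y z = if r z \in C then true else y == r z.
    move=> By; rewrite /f eq_sym (_ : y != r x) /=; last first.
      by apply: contraTneq By => ->; rewrite UrE negbK.
    have [rzC|rzC] := boolP (r z \in C); rewrite rxC /=; first by rewrite if_same.
    by rewrite eq_sym; case: eqP.
  under eq_bigr => y By do rewrite (eq_f y By).
  have [rzC|rzC] := ifP; first by rewrite sum1_card Bn muln1.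
  rewrite muln0 (bigD1 (r z)) ?UrE ?rzC //= eqxx big1 // => y /andP[_ /negPf->//].
(* Now [r x] is in [B], so [y = r x] is excluded: [n.+1] values of [y] are good when [r z] is in
   [C], none otherwise. *)
rewrite add0n big_distrr /=; apply: eq_bigr => z B'z.
have [rzC|rzC] := ifP; last first.
  by rewrite big1 ?muln0 // => y _; rewrite /f rzC (negPf rxC) if_same andbF.
rewrite (big_setD1 (r x)) /= ?UrE // /f eqxx add0n muln1.
apply/eqP; rewrite -eqSS -Bn (cardsD1 (r x) B) UrE rxC -sum1_card eqSS; apply/eqP.
apply: eq_bigr => y /[!inE] /andP[yr By]; rewrite eq_sym yr.
by case: eqP => [Dy|_]; rewrite ?rzC //; rewrite -Dy UrE rzC in By.
Qed.

End SymSums.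

(** * Full cycles and completions to a full cycle *)

Section FullCycles.

Variable T : finType.
Implicit Types (s k t : {perm T}) (U B C : {set T}).

Definition full s := [forall y, meets s [set y]].

Lemma meets1P s y : reflect (forall x, y \in porbit s x) (meets s [set y]).
Proof.
apply: (iffP forallP) => H x; last first.
  by apply/exists_inP; exists y; rewrite ?inE.
by have /exists_inP[z /set1P->] := H x.
Qed.

Lemma fullP s : reflect (forall x y, y \in porbit s x) (full s).
Proof.
apply: (iffP forallP) => [H x y | H y]; last by apply/meets1P => x.
by have /meets1P := H y; apply.
Qed.

Lemma full_meets1 s c : full s = meets s [set c].
Proof.
apply/idP/idP => [/fullP H | /meets1P H]; first by apply/meets1P.
apply/fullP => x y.
have := H x; have := H y; rewrite -!eq_porbit_mem => /eqP<- /eqP<-.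
exact: eqxx.
Qed.

Lemma fullJ s t : full (s ^ t)%g = full s.
Proof.
suff {s t} fullJS s t : full s -> full (s ^ t)%g.
  by apply/idP/idP=> [/fullJS-/(_ t^-1)%g|/fullJS//]; rewrite conjgK.
move=> /fullP H; apply/fullP => x y.
have /porbitP[m Dm] := H ((t^-1)%g x) ((t^-1)%g y).
apply/porbitP; exists m.
by rewrite -conjXg !permM -Dm permKV.
Qed.

Lemma full_mulC s t : full (s * t)%g = full (t * s)%g.
Proof. by rewrite -(fullJ _ s) conjgE -mulgA mulKg. Qed.

(** Being full means that every cycle passes through one chosen [c] in [U]. Splitting off [c]
    reduces to [sum_meets_Sym] with [C = [set c]]; each [x] in [U :\ c] is then counted for exactly
    one [y], its first return. *)
Lemma sum_full_Sym U s : U != set0 ->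
  \sum_(k in Sym U) full (s * k)%g = meets s U * (#|U|.-1)`!.
Proof.
case/set0Pn => c Uc; under eq_bigr => k _ do rewrite (full_meets1 _ c).
have [U'0|U'n0] := eqVneq (U :\ c) set0.
  have DU : U = [set c] by rewrite -(setD1K Uc) U'0 setU0.
  rewrite DU cards1 muln1 (big_pred1 1%g) ?mulg1 // => k.
  rewrite /= inE; apply/idP/eqP => [/perm_on_id->|->]; rewrite ?perm_on1 //.
  by rewrite cards1.
have [sU|NsU] := boolP (meets s U); last first.
  rewrite big1 // => k /[!inE] onk; apply/eqP; rewrite eqb0.
  by apply: contra NsU => /(meetsS (_ : _ \subset U)); rewrite sub1set meets_mul // => ->.
rewrite mul1n -(setD1K Uc) sum_SymU1 ?setD11 // setD1K //.
have eq_y y : y \in U ->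
    \sum_(k in Sym (U :\ c)) meets (s * (tperm c y * k))%g [set c] =
    (#|U :\ c|.-1)`! * \sum_(x in U :\ c) (ret U s x == y).
  move=> Uy; under eq_bigr do rewrite mulgA.
  have onU : perm_on U (tperm c y).
    apply: subset_trans (tperm_on c y) _.
    by apply/subsetP => z /[!inE] /orP[]/eqP->.
  rewrite sum_meets_Sym //; last by rewrite disjoint_sym disjoints1 setD11.
  rewrite setUC setD1K // meets_mul // sU mul1n; congr (_ * _).
  rewrite -sum1dep_card big_mkcondr; apply: eq_bigr => x _.
  rewrite ret_mul // inE -(inj_eq (@perm_inj _ (tperm c y))) tpermK tpermL.
  by case: eqP.
rewrite (eq_bigr _ eq_y) -big_distrr exchange_big /=.
under eq_bigr => x _.
  rewrite (bigD1 (ret U s x)) ?ret_in //= eqxx big1 => [|y /andP[_ /negPf]]; last first.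
    by rewrite eq_sym => ->.
  over.
rewrite sum1_card (cardsD1 c U) Uc /= -card_gt0 in U'n0 *.
by case: #|_| U'n0 => // m _; rewrite factS mulnC.
Qed.

(** A permutation satisfying [Q] stabilizes [B], so it factors uniquely as [t * k], with [k] its
    restriction to [B] and [t] fixing [B] pointwise. *)
Lemma sum_Sym_invariant (Q : pred {perm T}) B (F : {perm T} -> nat) :
    (forall t k, k \in Sym B -> Q (t * k)%g = Q t) ->
    (forall t x, Q t -> (t x \in B) = (x \in B)) ->
  \sum_(s | Q s) F s =
  \sum_(t | Q t && [forall x in B, t x == x]) \sum_(k in Sym B) F (t * k)%g.
Proof.
move=> QM QB; rewrite (partition_big (restr_perm B) (mem (Sym B))) /=; last first.
  by move=> s _; rewrite inE restr_perm_on.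
rewrite exchange_big; apply: eq_bigr => k Bk.
rewrite (reindex_inj (mulIg k)); apply: eq_bigl => t.
rewrite QM //; have [Qt|//] := boolP (Q t).
have nB : (t * k)%g \in 'N(B | 'P)%g.
  by apply/astabsP => x /=; rewrite apermE QB // QM.
rewrite /=; apply/eqP/forall_inP => [Dk x Bx | fixB].
  by rewrite -(inj_eq (@perm_inj _ k)) -permM -(restr_permE nB) // Dk.
apply/permP => x; have [Bx|NBx] := boolP (x \in B).
  by rewrite restr_permE // permM (eqP (fixB x Bx)).
rewrite (out_perm (restr_perm_on _ _)) // (out_perm _ NBx) //.
by rewrite inE in Bk.
Qed.

End FullCycles.

(** * Moving weight between two colors *)

Section TwoColors.

Variables (T I : finType).
Implicit Types (phi psi : {ffun T -> I}) (z s t k : {perm T}) (g : I -> nat).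

Definition fiber phi c := [set x | phi x == c].

Definition respects phi s := [forall x, phi (s x) == phi x].

Definition has_type g phi := [forall c, #|fiber phi c| == g c].

Definition long_products g z :=
  \sum_(phi | has_type g phi) \sum_(s | respects phi s) full (z * s)%g.

Lemma respects_Sym phi c t k :
  k \in Sym (fiber phi c) -> respects phi (t * k)%g = respects phi t.
Proof.
rewrite inE => onk; apply: eq_forallb => x; rewrite permM; congr (_ == _).
have [tx|/(out_perm onk)-> //] := boolP (t x \in fiber phi c).
have ktx : k (t x) \in fiber phi c by rewrite (perm_closed _ onk).
by move: tx ktx; rewrite !inE => /eqP-> /eqP->.
Qed.

(** Write [s] as [t], then a permutation of class [i], then one of class [j]. Summing out the last
    by [sum_full_Sym] leaves the condition that all cycles meet class [j]; summing out the middle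
    one is [sum_meets_Sym]. *)
Lemma sum_respects_full phi i j z : i != j ->
    fiber phi i != set0 -> fiber phi j != set0 ->
    let U := fiber phi i :|: fiber phi j in
  \sum_(s | respects phi s) full (z * s)%g =
  (#|fiber phi i|.-1)`! * (#|fiber phi j|.-1)`! *
  \sum_(t | respects phi t && [forall x in U, t x == x])
     meets (z * t)%g U * #|[set x in fiber phi i | ret U (z * t)%g x \in fiber phi j]|.
Proof.
move=> neq_ij i0 j0 U.
have dij : [disjoint fiber phi i & fiber phi j].
  rewrite -setI_eq0; apply/eqP/setP => x; rewrite !inE.
  by apply: contraNF neq_ij => /andP[/eqP-> /eqP->].
have respB c t x : respects phi t -> (t x \in fiber phi c) = (x \in fiber phi c).
  by move=> /forallP/(_ x)/eqP; rewrite !inE => ->.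
rewrite (@sum_Sym_invariant _ _ (fiber phi j)); last 2 first.
- by move=> t k; apply: respects_Sym.
- by move=> t x; apply: respB.
rewrite (@sum_Sym_invariant _ _ (fiber phi i)); last 2 first.
- move=> t k Sk; rewrite (respects_Sym _ Sk); congr (_ && _).
  apply: eq_forallb => x; have [jx|//] := boolP (x \in fiber phi j).
  rewrite inE in Sk; rewrite permM -{2}(out_perm Sk (_ : x \notin _)).
    by rewrite (inj_eq perm_inj).
  by rewrite (disjointFl dij jx).
- by move=> t x /andP[rt _]; apply: respB.
rewrite big_distrr /=; apply: eq_big => [t|t _].
  rewrite -andbA; congr (_ && _).
  apply/andP/forall_inP => [[/forall_inP fj /forall_inP fi] x | fU].
    by rewrite inE => /orP[/fi|/fj].
  by split; apply/forall_inP => x cx; apply: fU; rewrite inE cx ?orbT.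
under eq_bigr => k _.
  under eq_bigr do rewrite mulgA.
  rewrite sum_full_Sym // mulgA; over.
rewrite -big_distrl sum_meets_Sym //= -/U.
by rewrite mulnAC -(mulnA (nat_of_bool _)) (mulnC (nat_of_bool _)) -!mulnA.
Qed.

Definition merge i j phi := [ffun x => if phi x == j then i else phi x].

Lemma fiber_merge i j phi : fiber (merge i j phi) i = fiber phi i :|: fiber phi j.
Proof.
apply/setP => x; rewrite !inE ffunE orbC.
by case: (phi x == j); rewrite ?eqxx.
Qed.

Lemma respects_merge i j phi t :
    (forall x, x \in fiber phi i :|: fiber phi j -> t x = x) ->
  respects (merge i j phi) t = respects phi t.
Proof.
move=> fixU; apply: eq_forallb => x.
have [/fixU-> | NUx] := boolP (x \in fiber phi i :|: fiber phi j).
  by rewrite !eqxx.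
have NUtx : t x \notin fiber phi i :|: fiber phi j.
  by apply: contra NUx => /[dup] /fixU /perm_inj->.
by move: NUx NUtx; rewrite !inE !ffunE !negb_or => /andP[_ /negPf->] /andP[_ /negPf->].
Qed.

(** Colorings are grouped by their merged coloring [psi]. The set [U] and the admissible [t] depend
    only on [psi], so the sum over [phi] moves innermost, where it sees just the colors of [x] and
    of its first return. *)
Lemma long_products_merge i j g z : i != j -> 0 < g i -> 0 < g j ->
  long_products g z = (g i).-1`! * (g j).-1`! *
  \sum_psi \sum_(t | respects psi t && [forall x in fiber psi i, t x == x])
    meets (z * t)%g (fiber psi i) * \sum_(x in fiber psi i)
      #|[set phi | [&& has_type g phi, merge i j phi == psi, phi x == i
                     & phi (ret (fiber psi i) (z * t)%g x) == j]]|.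
Proof.
move=> neq_ij gi gj; rewrite /long_products (partition_big (merge i j) xpredT) //=.
rewrite big_distrr /=; apply: eq_bigr => psi _.
transitivity (\sum_(phi | has_type g phi && (merge i j phi == psi))
  (g i).-1`! * (g j).-1`! *
  \sum_(t | respects psi t && [forall x in fiber psi i, t x == x])
     meets (z * t)%g (fiber psi i) *
     \sum_(x in fiber psi i)
       ((phi x == i) && (phi (ret (fiber psi i) (z * t)%g x) == j))).
  apply: eq_bigr => phi /andP[/forallP type_phi /eqP Dpsi].
  have ni : fiber phi i != set0 by rewrite -card_gt0 (eqP (type_phi i)).
  have nj : fiber phi j != set0 by rewrite -card_gt0 (eqP (type_phi j)).
  rewrite (sum_respects_full _ neq_ij) // !(eqP (type_phi _)) -fiber_merge Dpsi.
  congr (_ * _); apply: eq_big => [t|t _].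
    have [/forall_inP fixU|_] := boolP [forall x in fiber psi i, t x == x];
      last by rewrite !andbF.
    rewrite !andbT.
    rewrite -Dpsi respects_merge // => x; rewrite -fiber_merge Dpsi.
    by move/fixU/eqP.
  congr (_ * _); rewrite -sum1dep_card -Dpsi fiber_merge.
  rewrite [RHS]big_mkcond [LHS]big_mkcond; apply: eq_bigr => x _.
  rewrite !inE; case: (phi x == i) => /=; last by rewrite if_same.
  by case: (phi _ == j).
rewrite -big_distrr /=; congr (_ * _); rewrite exchange_big; apply: eq_bigr => t _ /=.
rewrite -big_distrr /=; congr (_ * _); rewrite exchange_big; apply: eq_bigr => x _ /=.
rewrite -sum1dep_card big_mkcond [RHS]big_mkcond; apply: eq_bigr => phi _.
by do 2!case: (_ == _); case: (has_type _ _); case: (_ == _).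
Qed.

(** Splitting the merged class amounts to choosing class [i] without [x] as a subset of
    [U :\ x :\ y] of size [(g i).-1]. The two factorials in front are the denominator of this
    binomial coefficient. *)
Lemma card_split_fiber i j g psi x y : i != j -> 0 < g i -> 0 < g j ->
    x \in fiber psi i -> y \in fiber psi i ->
  (g i).-1`! * (g j).-1`! *
    #|[set phi | [&& has_type g phi, merge i j phi == psi, phi x == i & phi y == j]]| =
  [&& x != y, #|fiber psi i| == g i + g j, #|fiber psi j| == 0
    & [forall c, [|| c == i, c == j | #|fiber psi c| == g c]]] * (g i + g j - 2)`!.
Proof.
move=> neq_ij gi gj Ux Uy; set S := [set phi | _]; set U := fiber psi i in Ux Uy *.
set cond := [&& x != y, _, _ & _].
have [/and4P[neq_xy /eqP Ui /eqP Uj /forallP Uc] | NC] := boolP cond; last first.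
  suff -> : S = set0 by rewrite cards0 muln0.
  apply/setP => phi; rewrite !inE; apply: contraNF NC.
  case/and4P=> /forallP type_phi /eqP Dpsi /eqP phix /eqP phiy.
  have dij : [disjoint fiber phi i & fiber phi j].
    rewrite -setI_eq0; apply/eqP/setP => u; rewrite !inE.
    by apply: contraNF neq_ij => /andP[/eqP-> /eqP->].
  apply/and4P; split.
  - by apply: contraNneq neq_ij => Dx; rewrite -phix -phiy Dx.
  - rewrite /U -Dpsi fiber_merge cardsU disjoint_setI0 // cards0 subn0.
    by rewrite !(eqP (type_phi _)).
  - rewrite -Dpsi cards_eq0; apply/eqP/setP => u; rewrite !inE ffunE.
    by case: ifP => // _; rewrite (negPf neq_ij).
  - apply/forallP => c; case: eqVneq => //= ci; case: eqVneq => //= cj.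
    rewrite -(eqP (type_phi c)) -Dpsi; apply/eqP/eq_card => u; rewrite !inE ffunE.
    by have [->|//] := eqVneq (phi u) j; rewrite ![_ == c]eq_sym (negPf ci) (negPf cj).
(* [f] rebuilds the coloring from [D], its class [i] with [x] taken out. *)
pose f (D : {set T}) : {ffun T -> I} :=
  [ffun u => if u \in U then if u \in x |: D then i else j else psi u].
pose DS := [set D : {set T} | D \subset U :\ x :\ y & #|D| == (g i).-1].
have UiE u : (psi u == i) = (u \in U) by rewrite !inE.
have UjE u : psi u != j.
  by move/eqP: Uj; rewrite cards_eq0 => /eqP/setP/(_ u); rewrite !inE => ->.
have subU D : D \in DS -> [/\ x |: D \subset U, x \notin D, y \notin x |: D & #|x |: D| = g i].
  rewrite inE => /andP[/subsetP sDU /eqP oD].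
  have NDx : x \notin D by apply/negP => /sDU; rewrite !inE eqxx andbF.
  split=> //.
  - apply/subsetP => u /setU1P[->//|/sDU].
    by rewrite in_setD1 in_setD1 => /and3P[].
  - rewrite in_setU1 negb_or eq_sym neq_xy; apply/negP => /sDU.
    by rewrite !inE eqxx.
  - by rewrite cardsU1 NDx oD add1n prednK.
have fi D : D \in DS -> fiber (f D) i = x |: D.
  case/subU => /subsetP sDU _ _ _; apply/setP => u; rewrite inE ffunE.
  have [Uu|NUu] := boolP (u \in U); last first.
    by rewrite UiE (negPf NUu); apply/esym/negP => /sDU; apply/negP.
  by case: ifP => _; rewrite ?eqxx // eq_sym (negPf neq_ij).
have -> : S = f @: DS.
  apply/setP => phi; apply/idP/imsetP => [|[D DSD ->]].
    rewrite inE => /and4P[/forallP type_phi /eqP Dpsi /eqP phix /eqP phiy].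
    have Dphi : x |: fiber phi i :\ x = fiber phi i by rewrite setD1K // inE phix.
    exists (fiber phi i :\ x).
      rewrite inE; apply/andP; split.
        apply/subsetP => u; rewrite !inE => /andP[ux /eqP phiu]; rewrite ux /=.
        rewrite -Dpsi ffunE phiu (negPf neq_ij) eqxx andbT.
        by apply: contraNneq neq_ij => Du; rewrite -phiu -phiy Du.
      have := cardsD1 x (fiber phi i); rewrite (eqP (type_phi i)) inE phix eqxx.
      by move->.
    apply/ffunP => u; rewrite !ffunE Dphi !inE -Dpsi ffunE.
    have [->|phiuj] := eqVneq (phi u) j; first by rewrite eqxx [j == i]eq_sym (negPf neq_ij).
    by case: eqP.
  have [/subsetP sDU NDx NDy oD] := subU D DSD.
  rewrite inE; apply/and4P; split.
  - apply/forallP => c; have [->|ci] := eqVneq c i; first by rewrite fi // oD.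
    have [->|cj] := eqVneq c j.
      have -> : fiber (f D) j = U :\: (x |: D).
        apply/setP => u; rewrite inE ffunE in_setD.
        have [Uu|NUu] := boolP (u \in U); last by rewrite andbF (negPf (UjE u)).
        by case: (u \in _); rewrite ?eqxx // (negPf neq_ij).
      rewrite cardsD (setIidPr _); last by apply/subsetP.
      by rewrite Ui oD addKn.
    have := Uc c; rewrite (negPf ci) (negPf cj) /= => /eqP <-.
    apply/eqP/eq_card => u; rewrite !inE ffunE.
    have [Uu|//] := boolP (u \in U); rewrite -UiE in Uu; rewrite (eqP Uu).
    by case: ifP => _; rewrite ![_ == c]eq_sym (negPf ci) ?(negPf cj).
  - apply/eqP/ffunP => u; rewrite !ffunE.
    have [Uu|NUu] := boolP (u \in U); last by rewrite (negPf (UjE u)).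
    rewrite -UiE in Uu; rewrite (eqP Uu).
    by case: (u \in x |: D); rewrite ?eqxx ?(negPf neq_ij).
  - by rewrite ffunE Ux setU11.
  - by rewrite ffunE Uy (negPf NDy).
rewrite card_in_imset => [|D E DSD DSE eq_f]; last first.
  have [[_ NDx _ _] [_ NEx _ _]] := (subU D DSD, subU E DSE).
  by rewrite -(setU1K NDx) -(fi D) // eq_f (fi E) // setU1K.
have oU : #|U :\ x :\ y| = g i + g j - 2.
  have := cardsD1 x U; have := cardsD1 y (U :\ x); rewrite Ux Ui !inE.
  by rewrite eq_sym neq_xy (_ : psi y == i) ?UiE //=; lia.
rewrite cards_draws oU mul1n mulnC -(@bin_fact (g i + g j - 2) (g i).-1); last by lia.
by congr (_ * (_ * _`!)); lia.
Qed.

(** By [card_split_fiber], the type enters the merged sum only through [g i + g j] and the values at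
    the other colors. *)
Lemma long_products_move i j g h z : i != j ->
    0 < g i -> 0 < g j -> 0 < h i -> 0 < h j -> g i + g j = h i + h j ->
    (forall c, c != i -> c != j -> g c = h c) ->
  long_products g z = long_products h z.
Proof.
move=> neq_ij gi gj hi hj eq_ij eq_c.
rewrite !(long_products_merge _ neq_ij) // !big_distrr; apply: eq_bigr => psi _ /=.
rewrite !big_distrr; apply: eq_bigr => t _ /=.
have [zU|_] := boolP (meets _ _); last by rewrite !mul0n !muln0.
rewrite !mul1n !big_distrr; apply: eq_bigr => x Ux /=.
rewrite !card_split_fiber ?ret_in // eq_ij; congr (nat_of_bool [&& _, _, _ & _] * _).
apply: eq_forallb => c; case: eqVneq => //= ci; case: eqVneq => //= cj.
by rewrite eq_c.
Qed.

End TwoColors.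

(** * Independence of the color type *)

Section Types.

Variables (T I : finType).
Implicit Types (phi : {ffun T -> I}) (z s t : {perm T}) (g h : I -> nat).

Lemma eq_has_type g h : g =1 h -> @has_type T I g =1 has_type h.
Proof. by move=> eq_gh phi; apply: eq_forallb => c; rewrite eq_gh. Qed.

(** Induction on the total excess of [g] over [h]: one unit moves from a color [i] in excess to a
    color [j] in deficit. Types stay positive because [(g i).-1] is still at least [h i]. *)
Lemma long_products_type g h z :
    (forall c, 0 < g c) -> (forall c, 0 < h c) ->
    \sum_c g c = \sum_c h c ->
  @long_products T I g z = long_products h z.
Proof.
move Dd: (\sum_c (g c - h c)) => d.
elim: d g Dd => [|d IHd] g Dd g_gt0 h_gt0 eq_sum.
  apply: eq_bigl; apply: eq_has_type => c.
  (* Zero excess gives [g <= h] pointwise, and equality of the sums then forces equality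
     everywhere. *)
  have le_gh b : true -> g b <= h b ?= iff (g b == h b).
    move=> _; split=> //; rewrite -subn_eq0.
    by have/eqP := Dd; rewrite sum_nat_eq0 => /forallP/(_ b).
  have [_] := leqif_sum le_gh; rewrite eq_sum eqxx.
  by move/esym/forallP/(_ c)/eqP.
have [i gt_i] : exists i, h i < g i.
  apply/existsP; apply: contra_eqT Dd => /existsPn le_gh.
  by rewrite big1 // => c _; have := le_gh c; lia.
have [j lt_j] : exists j, g j < h j.
  apply/existsP; apply: contra_eqT eq_sum => /existsPn le_hg.
  rewrite neq_ltn; apply/orP; right.
  rewrite (bigD1 i) // [ltnRHS](bigD1 i) //= -addSn leq_add // leq_sum // => c _.
  by have := le_hg c; lia.
have neq_ji : j != i by apply: contraTneq lt_j => ->; lia.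
pose g' c := if c == i then (g i).-1 else if c == j then (g j).+1 else g c.
have g'i : g' i = (g i).-1 by rewrite /g' eqxx.
have g'j : g' j = (g j).+1 by rewrite /g' (negPf neq_ji) eqxx.
have g'c c : c != i -> c != j -> g c = g' c.
  by rewrite /g' => /negPf-> /negPf->.
have sumE (F : I -> nat) :
    \sum_c F c = F i + F j + \sum_(c | (c != i) && (c != j)) F c.
  by rewrite (bigD1 i) // (bigD1 j) //= addnA.
have hi := h_gt0 i.
have g'_gt0 c : 0 < g' c.
  by rewrite /g'; case: ifP => _; [lia | case: ifP].
rewrite (@long_products_move _ _ i j g g' z) ?g'i ?g'j //; try lia; last first.
  by rewrite eq_sym.
apply: IHd => //.
  apply/eqP; rewrite -eqSS -Dd !sumE g'i g'j; apply/eqP.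
  rewrite (eq_bigr (fun c => g c - h c)) => [|c /andP[/g'c + /[dup] cj]]; first by lia.
  by move=> ->.
rewrite -eq_sum !sumE g'i g'j (eq_bigr g) => [|c /andP[ci cj]]; last by rewrite -g'c.
by lia.
Qed.

Definition colorings g s :=
  #|[set phi : {ffun T -> I} | has_type g phi & respects phi s]|.

(** Summing over [s] outermost turns the pair count into a class-function weight on permutations,
    the form in which a single factor can be replaced. *)
Lemma long_productsE g z :
  @long_products T I g z = \sum_s colorings g s * full (z * s)%g.
Proof.
rewrite /long_products; under eq_bigr do rewrite big_mkcond.
rewrite exchange_big; apply: eq_bigr => s _ /=.
rewrite -big_mkcondr /colorings -sum1dep_card big_distrl; apply: eq_bigr => phi _.
by rewrite /= mul1n.
Qed.

Lemma coloringsJ g s t : colorings g (s ^ t)%g = colorings g s.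
Proof.
pose f r phi : {ffun T -> I} := [ffun x => phi (r x)].
have fK (r : {perm T}) : cancel (f (r^-1)%g) (f r).
  by move=> phi; apply/ffunP => x; rewrite !ffunE permK.
have f_inj : injective (f t).
  by apply: (can_inj (g := f (t^-1)%g)); have := fK (t^-1)%g; rewrite invgK.
rewrite /colorings -[RHS](card_preimset _ f_inj); apply: eq_card => phi.
rewrite !inE; congr (_ && _).
  apply: eq_forallb => c; congr (_ == _).
  rewrite -(card_preimset (fiber phi c) (@perm_inj _ t)); apply: eq_card => x.
  by rewrite !inE ffunE.
apply/forallP/forallP => H x.
  by have := H (t x); rewrite !ffunE conjgE !permM permK.
have := H ((t^-1)%g x).
by rewrite !ffunE conjgE !permM permKV.
Qed.

End Types.

(** * Replacing the factors one at a time *)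

Lemma sum_ffun_recl (R : finType) k (F : {ffun 'I_k.+1 -> R} -> nat) :
  \sum_f F f =
  \sum_x \sum_(f : {ffun 'I_k -> R})
     F [ffun i => if unlift ord0 i is Some j then f j else x].
Proof.
rewrite pair_big /=.
pose h (p : R * {ffun 'I_k -> R}) : {ffun 'I_k.+1 -> R} :=
  [ffun i => if unlift ord0 i is Some j then p.2 j else p.1].
pose h' (f : {ffun 'I_k.+1 -> R}) := (f ord0, [ffun j => f (lift ord0 j)]).
rewrite (reindex h) //; exists h' => [[x f] _|f _].
  rewrite /h' /h ffunE unlift_none; congr pair; apply/ffunP => j.
  by rewrite !ffunE liftK.
by apply/ffunP => i; rewrite ffunE; case: unliftP => [j|] ->; rewrite ?ffunE.
Qed.

(** Induction on the number of factors, for every prefix [z]: the tail is replaced with prefix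
    [z * s], then the head [s] with the tail fixed. *)
Lemma sum_full_products_swap (T : finType) k (V W : 'I_k -> {perm T} -> nat) :
    (forall i z, \sum_s V i s * full (z * s)%g = \sum_s W i s * full (z * s)%g) ->
  forall z,
  \sum_(f : {ffun 'I_k -> {perm T}})
     (\prod_i V i (f i)) * full (z * \prod_i f i)%g =
  \sum_(f : {ffun 'I_k -> {perm T}})
     (\prod_i W i (f i)) * full (z * \prod_i f i)%g.
Proof.
elim: k V W => [|k IHk] V W eqVW z.
  by apply: eq_bigr => f _; rewrite !big_ord0.
rewrite !sum_ffun_recl.
have recE (U : 'I_k.+1 -> {perm T} -> nat) (s : {perm T}) (f : {ffun 'I_k -> {perm T}}) :
    let f' := [ffun i => if unlift ord0 i is Some j then f j else s] in
    (\prod_i U i (f' i)) * full (z * \prod_i f' i)%g =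
    U ord0 s * (\prod_i U (lift ord0 i) (f i)) * full ((z * s) * \prod_i f i)%g.
  move=> f'; rewrite !big_ord_recl ffunE unlift_none mulgA.
  have f'l i : f' (lift ord0 i) = f i by rewrite ffunE liftK.
  rewrite (eq_bigr f) => [|i _]; last exact: f'l.
  by congr (_ * _); congr (_ * _); apply: eq_bigr => i _; rewrite f'l.
transitivity (\sum_s V ord0 s * \sum_(f : {ffun 'I_k -> {perm T}})
    (\prod_i W (lift ord0 i) (f i)) * full ((z * s) * \prod_i f i)%g).
  apply: eq_bigr => s _; under eq_bigr do rewrite recE -mulnA.
  rewrite -big_distrr /=; congr (_ * _).
  exact: (IHk (fun i => V (lift ord0 i)) (fun i => W (lift ord0 i)) (fun i => eqVW (lift ord0 i))).
under [RHS]eq_bigr => s _ do under eq_bigr do rewrite recE.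
under eq_bigr do rewrite big_distrr.
rewrite exchange_big [RHS]exchange_big; apply: eq_bigr => f _ /=.
(* Two rotations bring [s] to the end, so the hypothesis applies with the tail product times [z] as
   its prefix. *)
under eq_bigr do rewrite mulnCA -mulgA full_mulC -mulgA full_mulC.
under [RHS]eq_bigr do
  rewrite -mulnA mulnCA -mulgA full_mulC -mulgA full_mulC.
by rewrite -!big_distrr /=; congr (_ * _); apply: eqVW.
Qed.

(** * The long cycle and its conjugates *)

Lemma iter_long_cycle n m (x : 'I_n) :
  iter m (long_cycle n) x = (x + m) %% n :> nat.
Proof.
elim: m => [|m IHm]; first by rewrite addn0 modn_small.
by rewrite iterS permE /= IHm -addn1 modnDml addn1 addnS.
Qed.

Lemma full_long_cycle n : full (long_cycle n).
Proof.
apply/fullP => x y; apply/porbitP; exists (n - x + y); apply/val_inj.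
have ltx := ltn_ord x.
by rewrite /= permX iter_long_cycle addnA subnKC ?(ltnW ltx) // modnDl modn_small.
Qed.

(** Listing the single orbit as the iterates of [s] at a base point gives a bijection that carries
    [i |-> i + 1] to [s]. *)
Lemma full_conj_long_cycle n (s : 'S_n) :
  full s -> exists t, s = (long_cycle n ^ t)%g.
Proof.
case: n s => [|n] s; first by exists 1%g; apply/permP => -[].
move=> /fullP full_s; pose x0 : 'I_n.+1 := ord0.
have os : #|porbit s x0| = n.+1.
  by rewrite -[RHS]card_ord; apply: eq_card => x; rewrite full_s.
have f_inj : injective (fun i : 'I_n.+1 => iter i s x0).
  move=> i j /= eq_ij; have := uniq_traject_porbit s x0; rewrite os => Us.
  have lti (h : 'I_n.+1) : val h < n.+1 := ltn_ord h.
  apply/val_inj/eqP; rewrite -(nth_uniq x0 _ _ Us) ?size_traject ?lti //.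
  by rewrite !nth_traject ?lti //; apply/eqP.
exists (perm f_inj); apply/permP => x.
rewrite -(permKV (perm f_inj) x); move: (_ x) => i.
rewrite conjgE !permM permK !permE -iterS /=.
have [lti|gti] := ltnP i.+1 n.+1; first by rewrite modn_small.
(* Wrap-around: the last index goes back to 0, and [s] returns to [x0] after [n.+1] steps. *)
have -> : i = n :> nat by have := ltn_ord i; lia.
by have := iter_porbit s x0; rewrite os modnn.
Qed.

(** * Colored factorizations as a weighted sum over factorizations *)

Lemma porbit_respects (T I : finType) (phi : {ffun T -> I}) (s : {perm T}) :
  [forall a, forall b, (b \in porbit s a) ==> (phi a == phi b)] = respects phi s.
Proof.
apply/forallP/forallP => [H x | H x].
  have /forallP/(_ (s x))/implyP := H x; rewrite (mem_porbit s 1) eq_sym.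
  exact.
apply/forallP => y; apply/implyP => /porbitP[m ->]; rewrite permX eq_sym.
by elim: m => //= m /eqP <-; apply: H.
Qed.

Definition part_colorings n (c : seq nat) : 'S_n -> nat :=
  @colorings 'I_n 'I_(size c) (fun i => nth 0 c i).

(** For fixed [pi] the conditions on the colorings are independent in [t], so their number is a
    product. *)
Lemma count_colored_factorizationsE k n (gamma : 'I_k -> seq nat) :
    (forall t, is_composition n (gamma t)) ->
  count_colored_factorizations n gamma =
  \sum_(pi : {ffun 'I_k -> 'S_n} | compose pi == long_cycle n)
    \prod_t part_colorings (gamma t) (pi t).
Proof.
move=> comp_gamma.
pose P (pi : {ffun 'I_k -> 'S_n}) t (phi : {ffun 'I_n -> 'I_(size (gamma t))}) :=
  has_type (fun i : 'I_(size (gamma t)) => nth 0 (gamma t) i) phi && respects phi (pi t).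
transitivity (\sum_(pi : {ffun 'I_k -> 'S_n} | compose pi == long_cycle n)
  #|[set phi : {dffun forall t, {ffun 'I_n -> 'I_(size (gamma t))}}
       | [forall t, P pi t (phi t)]]|).
  under eq_bigr do rewrite -sum1dep_card.
  rewrite pair_big_dep /count_colored_factorizations /= -sum1dep_card.
  apply: eq_bigl => -[pi phi] /=.
  rewrite /has_color_compositions -andbA; congr (_ && _).
  apply/andP/forallP => [[/andP[_ /forallP resp] /forallP type] t | H].
    rewrite /P -porbit_respects resp andbT.
    by have /andP[] := type t.
  have typ t : has_type (fun i : 'I_(size (gamma t)) => nth 0 (gamma t) i) (phi t).
    by have /andP[] := H t.
  split; last by apply/forallP => t; rewrite eqxx /=; apply: typ.
  apply/andP; split; apply/forallP => t; last first.
    by rewrite porbit_respects; have /andP[] := H t.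
  (* Surjectivity comes from the color sizes, since all parts are positive. *)
  apply/forallP => c; apply/existsP.
  have /forallP/(_ c)/eqP fib := typ t.
  have /andP[/allP pos _] := comp_gamma t.
  have /card_gt0P[a] : 0 < #|fiber (phi t) c|.
    by rewrite fib; apply: pos; rewrite mem_nth.
  by rewrite inE => phia; exists a.
apply: eq_bigr => pi _; transitivity (foldr muln 1 [seq #|P pi t| | t : 'I_k]).
  rewrite -card_family; apply: eq_card => phi; rewrite inE.
  by apply/forallP/familyP => H t; have := H t.
rewrite foldrE big_image; apply: eq_bigr => t _.
by apply: eq_card => phi; rewrite !inE.
Qed.

Lemma compose_conj k n (pi : {ffun 'I_k -> 'S_n}) t :
  compose [ffun i => (pi i ^ t)%g] = (compose pi ^ t)%g.
Proof.
rewrite /compose (big_morph (conjg^~ t) (fun x y => conjMg x y t) (conj1g t)).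
by apply: eq_bigr => i _; rewrite ffunE.
Qed.

(** Conjugating all factors at once carries the factorizations of the long cycle to those of any
    full cycle, with the same weight as [W] is conjugation invariant. *)
Lemma sum_full_compositions k n (W : 'I_k -> 'S_n -> nat) :
    (forall i s t, W i (s ^ t)%g = W i s) ->
  \sum_(pi : {ffun 'I_k -> 'S_n}) (\prod_i W i (pi i)) * full (compose pi) =
  #|[set s : 'S_n | full s]| *
  \sum_(pi : {ffun 'I_k -> 'S_n} | compose pi == long_cycle n)
     \prod_i W i (pi i).
Proof.
move=> WJ; transitivity (\sum_(pi : {ffun 'I_k -> 'S_n} | full (compose pi))
  \prod_i W i (pi i)).
  rewrite [RHS]big_mkcond; apply: eq_bigr => pi _.
  by case: ifP; rewrite ?muln1 ?muln0.
rewrite -sum1dep_card big_distrl (partition_big (fun pi : {ffun 'I_k -> 'S_n} => compose pi) (@full _)) //=.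
apply: eq_bigr => s full_s; rewrite mul1n.
have [t Ds] := full_conj_long_cycle full_s.
pose h r (pi : {ffun 'I_k -> 'S_n}) := [ffun i => (pi i ^ r)%g].
have hK : cancel (h (t^-1)%g) (h t).
  by move=> pi; apply/ffunP => i; rewrite !ffunE conjgKV.
have hKV : cancel (h t) (h (t^-1)%g).
  by move=> pi; apply/ffunP => i; rewrite !ffunE conjgK.
rewrite (reindex (h t)); last by exists (h (t^-1)%g) => pi _; rewrite ?hK ?hKV.
apply: eq_big => [pi|pi _]; last by apply: eq_bigr => i _; rewrite ffunE WJ.
rewrite compose_conj Ds fullJ (inj_eq (conjg_inj t)).
by case: eqVneq => [->|_]; rewrite ?andbF // full_long_cycle.
Qed.

Theorem theorem1p3 (k n : nat) (hk : 2 <= k) (hn : 1 <= n)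
  (gamma delta : 'I_k -> seq nat)
  (hgamma : forall t : 'I_k, is_composition n (gamma t))
  (hdelta : forall t : 'I_k, is_composition n (delta t))
  (hlen : forall t : 'I_k, size (gamma t) = size (delta t)) :
  count_colored_factorizations n gamma = count_colored_factorizations n delta.
Proof.
rewrite !count_colored_factorizationsE //.
have full_gt0 : 0 < #|[set s : 'S_n | full s]|.
  by apply/card_gt0P; exists (long_cycle n); rewrite inE full_long_cycle.
(* Multiplying by the number of full cycles trades the fixed target for the condition [full], which
   is invariant under rotation. *)
apply/eqP; rewrite -(eqn_pmul2l full_gt0); apply/eqP.
have partsJ (c : 'I_k -> seq nat) i (s t : 'S_n) :
    part_colorings (c i) (s ^ t)%g = part_colorings (c i) s by exact: coloringsJ.
rewrite -(sum_full_compositions (partsJ gamma)) -(sum_full_compositions (partsJ delta)).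
(* Reversing the indices undoes the reversal in [compose]; the factor 1 is the initial prefix
   [z]. *)
have composeE (c : 'I_k -> seq nat) :
    \sum_(pi : {ffun 'I_k -> 'S_n})
       (\prod_i part_colorings (c i) (pi i)) * full (compose pi) =
    \sum_(pi : {ffun 'I_k -> 'S_n})
       (\prod_i part_colorings (c (rev_ord i)) (pi i)) * full (1 * \prod_i pi i)%g.
  pose h (pi : {ffun 'I_k -> 'S_n}) := [ffun i => pi (rev_ord i)].
  have hK : involutive h by move=> pi; apply/ffunP => i; rewrite !ffunE rev_ordK.
  rewrite (reindex_inj (inv_inj hK)); apply: eq_bigr => pi _.
  rewrite mul1g (reindex_inj rev_ord_inj); congr (_ * _).
    by apply: eq_bigr => i _; rewrite ffunE rev_ordK.
  by congr (nat_of_bool (full _)); apply: eq_bigr => i _; rewrite ffunE rev_ordK.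
rewrite !composeE; apply: (sum_full_products_swap
  (V := fun i => part_colorings (gamma (rev_ord i)))
  (W := fun i => part_colorings (delta (rev_ord i)))) => i z.
rewrite -!long_productsE; move: (rev_ord i) => {}i.
have sum_parts (c : seq nat) :
    is_composition n c -> \sum_(j < size c) nth 0 c j = n.
  by case/andP=> _ /eqP <-; rewrite sumnE (big_nth 0) big_mkord.
have part_gt0 (c : seq nat) (j : 'I_(size c)) : is_composition n c -> 0 < nth 0 c j.
  by case/andP=> /allP pos _; apply: pos; rewrite mem_nth.
(* These facts go into the goal so that rewriting with [hlen] gives them and both counts the same
   color set. *)
move: (sum_parts _ (hgamma i)) (fun j => part_gt0 _ j (hgamma i)).
rewrite hlen => sum_gamma gamma_gt0.
apply: long_products_type => //; first by move=> j; apply: part_gt0.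
by rewrite sum_gamma sum_parts.
Qed.
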